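(* Let $m,n\ge1$, $t=\mathrm{lcm}(m,n)$, and let $\Box:\mathcal M_{m\times n}\to\mathcal M_{t\times t}$ be $\Box(A)=A\otimes E_{t/m\times t/n}$. Then $\Box:\mathfrak{gl}(m\times n,\mathbb R)\to\mathfrak{gl}(t,\mathbb R)$ is a Lie algebra homomorphism. Moreover, $\mathrm{Im}(\Box)$ is a Lie subalgebra of $\mathfrak{gl}(t,\mathbb R)$.
   Context: $\mathcal M_{m\times n}$ is the set of real $m\times n$ matrices, $\otimes$ the Kronecker product, $E_n=\frac1{\sqrt n}(1,\dots,1)^T\in\mathbb R^n$, $E_{m\times n}=E_mE_n^T$. For $A,B\in\mathcal M_{m\times n}$ and $t=\mathrm{lcm}(m,n)$ the dimension-keeping product is $A\boxtimes B:=(A\otimes E_{t/n}^T)(B\otimes E_{t/m})\in\mathcal M_{m\times n}$. $\mathfrak{gl}(m\times n,\mathbb R)$ is the Lie algebra $\mathcal M_{m\times n}$ with bracket $[A,B]=A\boxtimes B-B\boxtimes A$; $\mathfrak{gl}(t,\mathbb R)$ is $\mathcal M_{t\times t}$ with the usual commutator. A Lie algebra homomorphism is a linear map preserving brackets. *)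

(* Defs.v *)
From HB Require Import structures.
From mathcomp Require Import all_boot all_order all_algebra.
From mathcomp Require Import mathcomp_extra boolp classical_sets reals.
From mathcomp Require Export mxtens.

Set Implicit Arguments.
Unset Strict Implicit.
Unset Printing Implicit Defensive.

Import Order.TTheory GRing.Theory Num.Theory.

Local Open Scope classical_set_scope.
Local Open Scope ring_scope.

Record lieAlgebra (K : fieldType) := LieAlgebra {
  lie_carrier :> lmodType K;
  lie_bracket : lie_carrier -> lie_carrier -> lie_carrier;
  lie_linearl : forall y, linear (lie_bracket^~ y);
  lie_linearr : forall x, linear (lie_bracket x);
  lie_alternating : forall x, lie_bracket x x = 0;
  lie_jacobi : forall x y z,
    lie_bracket x (lie_bracket y z) + lie_bracket y (lie_bracket z x)
      + lie_bracket z (lie_bracket x y) = 0 }.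

Definition lie_homomorphism (K : fieldType) (L L' : lieAlgebra K)
    (f : L -> L') : Prop :=
  linear f /\
  {morph f : x y / lie_bracket x y >-> lie_bracket x y}.

Definition lie_subalgebra (K : fieldType) (L : lieAlgebra K) (S : set L) : Prop :=
  [/\ S 0,
      forall a x y, S x -> S y -> S (a *: x + y)
    & forall x y, S x -> S y -> S (lie_bracket x y)].

Section Commutator.
Context (K : fieldType) (V : lmodType K) (mul : V -> V -> V).
Context (mull : forall y, linear (mul^~ y)) (mulr : forall x, linear (mul x)).
Context (mula : associative mul).

Let mulBl x y z : mul (x - y) z = mul x z - mul y z.
Proof. by rewrite addrC -scaleN1r mull scaleN1r addrC. Qed.

Let mulBr x y z : mul x (y - z) = mul x y - mul x z.
Proof. by rewrite addrC -scaleN1r mulr scaleN1r addrC. Qed.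

Definition commutator (x y : V) : V := mul x y - mul y x.

Fact commutator_linearl y : linear (commutator^~ y).
Proof.
by move=> a u v; rewrite /commutator mull mulr scalerBr opprD addrACA.
Qed.

Fact commutator_linearr x : linear (commutator x).
Proof.
by move=> a u v; rewrite /commutator mull mulr scalerBr opprD addrACA.
Qed.

Fact commutator_alternating x : commutator x x = 0.
Proof. exact: subrr. Qed.

Fact commutator_jacobi x y z :
  commutator x (commutator y z) + commutator y (commutator z x)
    + commutator z (commutator x y) = 0.
Proof.
rewrite /commutator !mulBl !mulBr !mula !opprB.
have subrACA (p q r s : V) : p - q + (r - s) = (p + r) - (q + s).
  by rewrite opprD addrACA.
rewrite !subrACA; apply/eqP; rewrite subr_eq0 !addrA; apply/eqP.
by rewrite [LHS](ACl (4*3*6*5*2*1)).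
Qed.

Definition commutator_lieAlgebra : lieAlgebra K :=
  LieAlgebra commutator_linearl commutator_linearr
             commutator_alternating commutator_jacobi.

End Commutator.

Section DimensionKeeping.
Context (R : realType).

Definition Evec (n : nat) : 'cV[R]_n := const_mx (Num.sqrt n%:R)^-1.

Definition Emx (m n : nat) : 'M[R]_(m, n) := Evec m *m (Evec n)^T.

Fact lcm_divl m n : (m * (lcmn m n %/ m) = lcmn m n)%N.
Proof. by rewrite mulnC divnK // dvdn_lcml. Qed.

Fact lcm_divr m n : (n * (lcmn m n %/ n) = lcmn m n)%N.
Proof. by rewrite mulnC divnK // dvdn_lcmr. Qed.

(* Throughout, t = lcmn m n. The casts only transport types along m * 1 = m,
   n * 1 = n, m * (t / m) = t and n * (t / n) = t; entries stay in place. *)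
Definition dkmul m n (A B : 'M[R]_(m, n)) : 'M[R]_(m, n) :=
  castmx (muln1 m, lcm_divr m n) (A *t (Evec (lcmn m n %/ n))^T)
  *m castmx (lcm_divl m n, muln1 n) (B *t Evec (lcmn m n %/ m)).

Definition dkbox m n (A : 'M[R]_(m, n)) : 'M[R]_(lcmn m n) :=
  castmx (lcm_divl m n, lcm_divr m n)
    (A *t Emx (lcmn m n %/ m) (lcmn m n %/ n)).

Fact tensmx_rowE p q r t (M : 'M[R]_(p, q)) (N : 'rV[R]_r)
    (e : (q * r = t)%N) :
  castmx (muln1 p, e) (M *t N) = M *m castmx (muln1 q, e) (1%:M *t N).
Proof.
have castmxl a b c a' b' (ea : a' = a) (eb : b' = b)
    (X : 'M[R]_(a, b)) (Y : 'M[R]_(b', c)) :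
    castmx (ea, erefl) (castmx (esym ea, esym eb) X *m Y)
    = X *m castmx (eb, erefl) Y.
  by case: a / ea X => X; case: b / eb X => X.
case: t / e; rewrite -[N in LHS]mul1mx -[M in LHS]mulmx1 -tensmx_mul.
by rewrite tens_mx_scalar scale1r castmxl.
Qed.

Fact tensmx_colE p q r t (M : 'M[R]_(p, q)) (N : 'cV[R]_r)
    (e : (p * r = t)%N) :
  castmx (e, muln1 q) (M *t N) = castmx (e, muln1 p) (1%:M *t N) *m M.
Proof.
have castmxr a b c a' b' (ea : a' = a) (eb : b' = b)
    (X : 'M[R]_(a, b)) (Y : 'M[R]_(c, a')) :
    castmx (erefl, eb) (Y *m castmx (esym ea, esym eb) X)
    = castmx (erefl, ea) Y *m X.
  by case: a / ea X => X; case: b / eb X => X.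
case: t / e; rewrite -[N in LHS]mulmx1 -[M in LHS]mul1mx -tensmx_mul.
by rewrite tens_mx_scalar scale1r castmxr.
Qed.

Definition dkbridge m n : 'M[R]_(n, m) :=
  castmx (muln1 n, lcm_divr m n) (1%:M *t (Evec (lcmn m n %/ n))^T)
  *m castmx (lcm_divl m n, muln1 m) (1%:M *t Evec (lcmn m n %/ m)).

Fact dkmulE m n (A B : 'M[R]_(m, n)) :
  dkmul A B = A *m dkbridge m n *m B.
Proof. by rewrite /dkmul tensmx_rowE tensmx_colE !mulmxA. Qed.

Fact dkmul_linearl m n (B : 'M[R]_(m, n)) : linear (@dkmul m n ^~ B).
Proof. by move=> a A A'; rewrite !dkmulE !mulmxDl -!scalemxAl. Qed.

Fact dkmul_linearr m n (A : 'M[R]_(m, n)) : linear (dkmul A).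
Proof. by move=> a B B'; rewrite !dkmulE mulmxDr -scalemxAr. Qed.

Fact dkmulA m n : associative (@dkmul m n).
Proof. by move=> A B C; rewrite !dkmulE !mulmxA. Qed.

Fact mulmx_linearl n (B : 'M[R]_n) : linear (@mulmx R n n n ^~ B).
Proof. by move=> a A A'; rewrite mulmxDl -scalemxAl. Qed.

Fact mulmx_linearr n (A : 'M[R]_n) : linear (@mulmx R n n n A).
Proof. by move=> a B B'; rewrite mulmxDr -scalemxAr. Qed.

Definition gl_rect (m n : nat) : lieAlgebra R :=
  commutator_lieAlgebra (@dkmul_linearl m n) (@dkmul_linearr m n)
                        (@dkmulA m n).

Definition gl (t : nat) : lieAlgebra R :=
  commutator_lieAlgebra (@mulmx_linearl t) (@mulmx_linearr t)
                        (@mulmxA R t t t t).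

End DimensionKeeping.

Arguments dkbox {R} m n A.

(* Main.v *)
Require Import Defs.
From mathcomp Require Import all_boot all_order all_algebra.
From mathcomp Require Import boolp classical_sets reals.

(** Write a = t / m and b = t / n. Since E_(a x b) = E_a E_b^T, the map Box
    factors through the original matrix by fixed matrices on both sides:
      Box(A) = P A Q,  with P = I_m (x) E_a  and  Q = I_n (x) E_b^T.
    The very same two matrices, multiplied in the other order, form the bridge
    of the dimension-keeping product, A [x] B = A (Q P) B. Hence
      Box(A) Box(B) = P A (Q P) B Q = Box(A [x] B),
    so Box is multiplicative. The first formula shows that it is also linear,
    so it preserves commutators, and the image of any Lie algebra
    homomorphism is a Lie subalgebra. *)

Set Implicit Arguments.
Unset Strict Implicit.
Unset Printing Implicit Defensive.

Import GRing.Theory.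

Local Open Scope classical_set_scope.
Local Open Scope ring_scope.

Lemma lie_homomorphism_range (K : fieldType) (L L' : lieAlgebra K)
    (f : L -> L') : lie_homomorphism f -> lie_subalgebra (range f).
Proof.
move=> [f_lin f_bracket]; split.
(* The witness for 0 is itself 0, written so that linearity applies. *)
- by exists (-1 *: 0 + 0) => //; rewrite f_lin scaleN1r addNr.
- by move=> a _ _ [x _ <-] [y _ <-]; exists (a *: x + y); rewrite ?f_lin.
- by move=> _ _ [x _ <-] [y _ <-]; exists (lie_bracket x y);
    rewrite ?f_bracket.
Qed.

(** Unlike [castmx_mul], this also casts the inner dimension, which is m * 1
    when a Kronecker product with a column meets one with a row. *)
Lemma castmx_mulmx (R : pzRingType) (m m' n n' p p' : nat)
    (em : m = m') (en : n = n') (ep : p = p')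
    (A : 'M[R]_(m, n)) (B : 'M[R]_(n, p)) :
  castmx (em, ep) (A *m B) = castmx (em, en) A *m castmx (en, ep) B.
Proof. by case: m' / em; case: n' / en; case: p' / ep. Qed.

Section Box.
Context (R : realType) (m n : nat).

Definition box_col : 'M[R]_(lcmn m n, m) :=
  castmx (lcm_divl m n, muln1 m) (1%:M *t Evec R (lcmn m n %/ m)).

Definition box_row : 'M[R]_(n, lcmn m n) :=
  castmx (muln1 n, lcm_divr m n) (1%:M *t (Evec R (lcmn m n %/ n))^T).

(** The mixed-product rule splits A (x) (E_a E_b^T) as
    (I_m (x) E_a) (A (x) E_b^T), and again A (x) E_b^T as
    A (I_n (x) E_b^T). *)
Lemma dkboxE (A : 'M[R]_(m, n)) : dkbox m n A = box_col *m A *m box_row.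
Proof.
rewrite /dkbox /Emx -{1}[A]mul1mx -tensmx_mul.
by rewrite (castmx_mulmx _ (muln1 m)) tensmx_rowE mulmxA.
Qed.

Lemma dkbox_linear : linear (@dkbox R m n).
Proof.
by move=> a A B; rewrite !dkboxE mulmxDr mulmxDl -scalemxAr -scalemxAl.
Qed.

(** Between A and B the product of the two boxes carries exactly
    box_row *m box_col, which is the bridge of the dimension-keeping
    product. *)
Lemma dkboxM (A B : 'M[R]_(m, n)) :
  dkbox m n (dkmul A B) = dkbox m n A *m dkbox m n B.
Proof. by rewrite !dkboxE dkmulE /dkbridge -/box_col -/box_row !mulmxA. Qed.

Lemma dkbox_lie_homomorphism :
  lie_homomorphism (L := gl_rect R m n) (L' := gl R (lcmn m n)) (dkbox m n).
Proof.
split; first exact: dkbox_linear.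
move=> A B; rewrite /= /commutator -!dkboxM.
by rewrite addrC -scaleN1r dkbox_linear scaleN1r addrC.
Qed.

End Box.

Theorem proposition12p21 (R : realType) (m n : nat)
    (m_ge1 : (1 <= m)%N) (n_ge1 : (1 <= n)%N) :
  lie_homomorphism (L := gl_rect R m n) (L' := gl R (lcmn m n)) (dkbox m n) /\
  lie_subalgebra (L := gl R (lcmn m n)) (range (dkbox m n)).
Proof.
have box_hom := dkbox_lie_homomorphism R m n.
by split=> //; exact: lie_homomorphism_range box_hom.
Qed.
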